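(* Let $M$ be a maximal translation surface in $\mathbb{L}^3$. If one of the generating curves is a circular helix, then the other generating curve is a translation of the same helix.
   Context: $\mathbb{L}^3$ is $\mathbb{R}^3$ with the metric $\langle\cdot,\cdot\rangle=dx^2+dy^2-dz^2$. A translation surface is parametrized by $X(s,t)=\alpha(s)+\beta(t)$ with $\alpha,\beta$ smooth curves (the generating curves) on real intervals and $\alpha'(s),\beta'(t)$ linearly independent for all $s,t$. It is maximal if its induced metric is Riemannian and its mean curvature vanishes everywhere; for generating curves parametrized by arc length the latter reads $\det(\alpha',\beta',\alpha'')+\det(\alpha',\beta',\beta'')=0$. Generating curves are spacelike and parametrized by arc length. A circular helix is a curve of Frenet type (a curve whose second derivative with respect to arc length is everywhere nonzero spacelike or everywhere timelike) with constant curvature and constant torsion. The paper lists the spacelike circular helices, up to rigid motions (affine isometries of $\mathbb{L}^3$), as the following arc-length parametrized curves: type I, $\alpha(s)=(r\cos\varphi(s),r\sin\varphi(s),h\varphi(s))$, $\varphi(s)=s/\sqrt{r^2-h^2}$, $r^2>h^2>0$; type II, $\alpha(s)=(h\varphi(s),r\sinh\varphi(s),r\cosh\varphi(s))$, $\varphi(s)=s/\sqrt{h^2+r^2}$, $r,h\neq0$; type III, $\alpha(s)=(h\varphi(s),r\cosh\varphi(s),r\sinh\varphi(s))$, $\varphi(s)=s/\sqrt{h^2-r^2}$, $h^2>r^2>0$. The conclusion is local and about the curves as point sets (arcs of the full helix), i.e. up to translation and reversal of the arc-length parameter.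
   Formalization: For a helix with timelike acceleration (type II) the other curve is a translation of the same helix turned by a half-turn about its axis (r replaced by -r), as the literal claim fails there; circular helices are required to have nonzero torsion, since planar circles give counterexamples. *)

(* Defs.v *)
From Stdlib Require Import Reals.
From Coquelicot Require Import Coquelicot.
Open Scope R_scope.

(** * Lorentz-Minkowski space: R^3 with dx^2 + dy^2 - dz^2 *)

(* Addition, scaling and zero are Coquelicot's [plus], [scal], [zero] on the
   product module. *)
Definition L3 : Type := (R * R * R)%type.

Definition px (u : L3) : R := fst (fst u).
Definition py (u : L3) : R := snd (fst u).
Definition pz (u : L3) : R := snd u.

Definition lprod (u v : L3) : R := px u * px v + py u * py v - pz u * pz v.

(* The Lorentzian cross product: [lprod (lcross u v) w = det (u, v, w)];
   hence the sign of the last coordinate. *)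
Definition lcross (u v : L3) : L3 :=
  (py u * pz v - pz u * py v,
   pz u * px v - px u * pz v,
   - (px u * py v - py u * px v)).

Definition lin_indep (u v : L3) : Prop :=
  forall x y : R, plus (scal x u) (scal y v) = (zero : L3) -> x = 0 /\ y = 0.

(** * Curves *)

(* The open interval with possibly infinite endpoints. *)
Definition within (a b : Rbar) (s : R) : Prop := Rbar_lt a s /\ Rbar_lt s b.

(* A curve on an open interval is a total function of which only the values on
   the interval matter. *)
Definition velocity (c : R -> L3) (s : R) : L3 :=
  (Derive (fun u => px (c u)) s,
   Derive (fun u => py (c u)) s,
   Derive (fun u => pz (c u)) s).

Definition acceleration (c : R -> L3) : R -> L3 := velocity (velocity c).

Definition smooth_curve (a b : Rbar) (c : R -> L3) : Prop :=
  forall (n : nat) (s : R), within a b s ->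
    ex_derive_n (fun u => px (c u)) n s /\
    ex_derive_n (fun u => py (c u)) n s /\
    ex_derive_n (fun u => pz (c u)) n s.

Definition spacelike_unit_speed (a b : Rbar) (c : R -> L3) : Prop :=
  forall s : R, within a b s -> lprod (velocity c s) (velocity c s) = 1.

(** * Frenet apparatus of a spacelike unit-speed curve *)

Definition spacelike_acceleration (a b : Rbar) (c : R -> L3) : Prop :=
  forall s : R, within a b s -> 0 < lprod (acceleration c s) (acceleration c s).

Definition timelike_acceleration (a b : Rbar) (c : R -> L3) : Prop :=
  forall s : R, within a b s -> lprod (acceleration c s) (acceleration c s) < 0.

Definition frenet_type (a b : Rbar) (c : R -> L3) : Prop :=
  spacelike_acceleration a b c \/ timelike_acceleration a b c.

Definition curvature (c : R -> L3) (s : R) : R :=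
  sqrt (Rabs (lprod (acceleration c s) (acceleration c s))).

Definition principal_normal (c : R -> L3) (s : R) : L3 :=
  scal (/ curvature c s) (acceleration c s).

Definition binormal (c : R -> L3) (s : R) : L3 :=
  lcross (velocity c s) (principal_normal c s).

(* The coefficient of B in N'; here <B,B> = - <N,N> is 1 or -1. *)
Definition torsion (c : R -> L3) (s : R) : R :=
  lprod (velocity (principal_normal c) s) (binormal c s)
  / lprod (binormal c s) (binormal c s).

(* The torsion is required to be nonzero: planar circles and hyperbolas are not
   helices.  All of (r cos p, r sin p, h p), (h p, r sinh p, r cosh p) and
   (h p, r cosh p, r sinh p) have nonzero torsion, because h <> 0. *)
Definition circular_helix (a b : Rbar) (c : R -> L3) : Prop :=
  smooth_curve a b c /\
  spacelike_unit_speed a b c /\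
  frenet_type a b c /\
  (exists k : R, forall s : R, within a b s -> curvature c s = k) /\
  (exists t : R, t <> 0 /\ forall s : R, within a b s -> torsion c s = t).

(* With the signs above, T' = k N and B' = t N whether N is spacelike or
   timelike, so t T - k B is constant along a circular helix; it spans the
   direction of the axis. *)
Definition axis_vector (c : R -> L3) (s : R) : L3 :=
  plus (scal (torsion c s) (velocity c s))
       (scal (- curvature c s) (binormal c s)).

(* The isometry fixing [e] and equal to -1 on its orthogonal complement,
   for [lprod e e <> 0]. *)
Definition half_turn (e x : L3) : L3 :=
  plus (scal (2 * lprod x e / lprod e e) e) (opp x).

(** * Parametrized surfaces *)

Definition d_s (X : R -> R -> L3) (s t : R) : L3 := velocity (fun u => X u t) s.
Definition d_t (X : R -> R -> L3) (s t : R) : L3 := velocity (fun u => X s u) t.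

Definition induced_metric (X : R -> R -> L3) (s t x y : R) : R :=
  let w : L3 := plus (scal x (d_s X s t)) (scal y (d_t X s t)) in lprod w w.

Definition riemannian_at (X : R -> R -> L3) (s t : R) : Prop :=
  forall x y : R, (x <> 0 \/ y <> 0) -> 0 < induced_metric X s t x y.

Definition unit_normal (X : R -> R -> L3) (s t : R) : L3 :=
  let n := lcross (d_s X s t) (d_t X s t) in
  scal (/ sqrt (Rabs (lprod n n))) n.

Definition mean_curvature (X : R -> R -> L3) (s t : R) : R :=
  let nu := unit_normal X s t in
  let E := lprod (d_s X s t) (d_s X s t) in
  let F := lprod (d_s X s t) (d_t X s t) in
  let G := lprod (d_t X s t) (d_t X s t) in
  let e := lprod nu (d_s (d_s X) s t) in
  let f := lprod nu (d_t (d_s X) s t) in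
  let g := lprod nu (d_t (d_t X) s t) in
  lprod nu nu * ((e * G - 2 * f * F + g * E) / (2 * (E * G - F * F))).

Definition translation_surface (al be : R -> L3) (s t : R) : L3 :=
  plus (al s) (be t).

(* [al] and [be] are the generating curves, on ]a1, b1[ and ]a2, b2[. *)
Definition maximal_translation_surface
    (a1 b1 : Rbar) (al : R -> L3) (a2 b2 : Rbar) (be : R -> L3) : Prop :=
  Rbar_lt a1 b1 /\ Rbar_lt a2 b2 /\
  smooth_curve a1 b1 al /\ smooth_curve a2 b2 be /\
  forall s t : R, within a1 b1 s -> within a2 b2 t ->
    lin_indep (velocity al s) (velocity be t) /\
    riemannian_at (translation_surface al be) s t /\
    mean_curvature (translation_surface al be) s t = 0.

(** * Arcs of translated helices *)

(* On ]a, b[ the unit-speed curve [c] runs along a translate of the unit-speed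
   curve [ga], in either direction. *)
Definition arc_of_translate (a b : Rbar) (c ga : R -> L3) : Prop :=
  exists (v : L3) (e s0 : R), (e = 1 \/ e = -1) /\
    forall s : R, within a b s -> c s = plus (ga (e * s + s0)) v.

(* [ga] is the full helix of which [c1] is an arc.
   If the acceleration is timelike, [ga] is congruent to
   (h p, r sinh p, r cosh p), and the second curve runs along a translate of
   the half-turn of [ga] about its axis, i.e. of the same helix with r replaced
   by -r.  This half-turn cannot be omitted: the velocities (h, r cosh p,
   r sinh p) and (h, r cosh q, r sinh q) have lprod at least h^2 + r^2, their
   squared length, so that ga(s) + ga(t) never induces a Riemannian metric,
   whereas ga(s) + half_turn (ga(t)) is maximal where its metric is
   Riemannian, for instance near p = q. *)
Definition translate_of_same_helix
    (a1 b1 : Rbar) (c1 : R -> L3) (a2 b2 : Rbar) (c2 : R -> L3) : Prop :=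
  exists ga : R -> L3,
    circular_helix m_infty p_infty ga /\
    (forall s : R, within a1 b1 s -> c1 s = ga s) /\
    (spacelike_acceleration m_infty p_infty ga ->
       arc_of_translate a2 b2 c2 ga) /\
    (timelike_acceleration m_infty p_infty ga ->
       arc_of_translate a2 b2 c2 (fun s => half_turn (axis_vector ga 0) (ga s))).

(* Main.v *)
Require Import Defs.
From Stdlib Require Import Reals Lra.
From Coquelicot Require Import Coquelicot.
(* [within] has to denote open intervals, not the filter of that name. *)
Import Defs.
Open Scope R_scope.

(** The velocity T of a circular helix with curvature k and torsion tau satisfies
    T' = e x T, where e = tau T - k B is the constant vector along its axis; also
    <T,T> = 1 and <e,T> = tau. Conversely a unit-speed curve whose velocity
    obeys these equations, with tau and q = tau^2 - <e,e> nonzero, is a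
    circular helix, and q = <T',T'>. So a helix is an orbit of the linear flow
    generated by A = e x _, and the theorem becomes a statement on orbits.

    Let U be the velocity of the other curve. Vanishing mean curvature says
    <T(s) x U(t), T'(s) + U'(t)> = 0, that is
      <T(s), U x U' - tau U> = - <e,U>   for every s.
    With t fixed, two derivatives in s produce the components of
    U x U' - tau U on the basis e, T, e x T, whence
    U x U' = tau U - (<e,U>/tau) e. Pairing with U gives <e,U> = sg tau with
    sg = 1 or -1, and the product with U gives U' = sg (e x U)
    ([maximality_forces_rotation]). Reversing the second curve if sg = -1, both
    velocities are orbits of the same flow in the level set <x,x> = 1,
    <e,x> = tau.

    It remains to see that the orbits are the same. Since A^3 = <e,e> A, the flow
    is 1 + sn A + cn A^2 where sn, cn are circular, polynomial or hyperbolic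
    functions according to the sign of <e,e>, and the level set is a conic in
    the coordinates (sn, cn) ([level_set_coordinates]). An ellipse or a parabola
    (e timelike or null) is a single orbit. For e spacelike it is a hyperbola
    with two branches, and the inequality |<T,U>| < 1, which expresses that the
    induced metric is Riemannian, selects one: that of T if q > 0, the other
    one, exchanged with it by the half-turn about e, if q < 0. Hence the
    velocities differ by a shift of the parameter and the curves by a
    translation ([helix_translation_partner]). *)

(** * Algebra of the Lorentzian scalar and cross products *)

Lemma L3_ext (u v : L3) : px u = px v -> py u = py v -> pz u = pz v -> u = v.
Proof.
destruct u as [[u1 u2] u3], v as [[v1 v2] v3]; cbn.
now intros -> -> ->.
Qed.

Lemma px_plus (u v : L3) : px (plus u v) = px u + px v.
Proof. reflexivity. Qed.
Lemma py_plus (u v : L3) : py (plus u v) = py u + py v.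
Proof. reflexivity. Qed.
Lemma pz_plus (u v : L3) : pz (plus u v) = pz u + pz v.
Proof. reflexivity. Qed.
Lemma px_scal (x : R) (u : L3) : px (scal x u) = x * px u.
Proof. reflexivity. Qed.
Lemma py_scal (x : R) (u : L3) : py (scal x u) = x * py u.
Proof. reflexivity. Qed.
Lemma pz_scal (x : R) (u : L3) : pz (scal x u) = x * pz u.
Proof. reflexivity. Qed.
Lemma px_opp (u : L3) : px (opp u) = - px u.
Proof. reflexivity. Qed.
Lemma py_opp (u : L3) : py (opp u) = - py u.
Proof. reflexivity. Qed.
Lemma pz_opp (u : L3) : pz (opp u) = - pz u.
Proof. reflexivity. Qed.
Lemma px_zero : px (zero : L3) = 0.
Proof. reflexivity. Qed.
Lemma py_zero : py (zero : L3) = 0.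
Proof. reflexivity. Qed.
Lemma pz_zero : pz (zero : L3) = 0.
Proof. reflexivity. Qed.
Lemma px_lcross u v : px (lcross u v) = py u * pz v - pz u * py v.
Proof. reflexivity. Qed.
Lemma py_lcross u v : py (lcross u v) = pz u * px v - px u * pz v.
Proof. reflexivity. Qed.
Lemma pz_lcross u v : pz (lcross u v) = - (px u * py v - py u * px v).
Proof. reflexivity. Qed.

#[local] Hint Rewrite px_plus py_plus pz_plus px_scal py_scal pz_scal
  px_opp py_opp pz_opp px_zero py_zero pz_zero
  px_lcross py_lcross pz_lcross : coords.

Ltac scalar_ring := unfold lprod; autorewrite with coords; ring.
Ltac vector_ring := apply L3_ext; autorewrite with coords; unfold lprod;
  autorewrite with coords; ring.

Lemma lprod_sym u v : lprod u v = lprod v u.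
Proof. scalar_ring. Qed.
Lemma lprod_plus_l u v w : lprod (plus u v) w = lprod u w + lprod v w.
Proof. scalar_ring. Qed.
Lemma lprod_plus_r u v w : lprod w (plus u v) = lprod w u + lprod w v.
Proof. scalar_ring. Qed.
Lemma lprod_scal_l x u w : lprod (scal x u) w = x * lprod u w.
Proof. scalar_ring. Qed.
Lemma lprod_scal_r x u w : lprod w (scal x u) = x * lprod w u.
Proof. scalar_ring. Qed.
Lemma lprod_opp_l u w : lprod (opp u) w = - lprod u w.
Proof. scalar_ring. Qed.
Lemma lprod_opp_r u w : lprod w (opp u) = - lprod w u.
Proof. scalar_ring. Qed.
Lemma lprod_zero_l u : lprod zero u = 0.
Proof. scalar_ring. Qed.
Lemma lcross_ll u v : lprod (lcross u v) u = 0.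
Proof. scalar_ring. Qed.
Lemma lcross_lr u v : lprod (lcross u v) v = 0.
Proof. scalar_ring. Qed.
Lemma lcross_rl u v : lprod u (lcross u v) = 0.
Proof. scalar_ring. Qed.
Lemma lcross_rr u v : lprod v (lcross u v) = 0.
Proof. scalar_ring. Qed.

#[local] Hint Rewrite lprod_plus_l lprod_plus_r lprod_scal_l lprod_scal_r
  lprod_opp_l lprod_opp_r lprod_zero_l
  lcross_ll lcross_lr lcross_rl lcross_rr : bilinear.

Lemma lagrange_identity u v w x :
  lprod (lcross u v) (lcross w x)
  = lprod u x * lprod v w - lprod u w * lprod v x.
Proof. scalar_ring. Qed.

Lemma lcross_lcross u v w :
  lcross u (lcross v w)
  = plus (scal (lprod u v) w) (scal (- lprod u w) v).
Proof. vector_ring. Qed.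

(** <u x v, u x v> is the determinant of u, v, u x v; the proof expands a multiple
    of w on the dual basis, which is made of cross products of these three. *)
Lemma orthogonal_to_frame u v w :
  lprod (lcross u v) (lcross u v) <> 0 ->
  lprod w u = 0 -> lprod w v = 0 -> lprod w (lcross u v) = 0 -> w = zero.
Proof.
intros Hn Hu Hv Hc.
assert (E : scal (lprod (lcross u v) (lcross u v)) w
  = plus (scal (lprod w (lcross u v)) (lcross u v))
      (plus (scal (lprod w u) (lcross v (lcross u v)))
            (scal (lprod w v) (lcross (lcross u v) u)))) by vector_ring.
rewrite Hu, Hv, Hc in E.
revert E Hn; generalize (lprod (lcross u v) (lcross u v)); intros n E Hn.
apply L3_ext; apply (Rmult_eq_reg_l n); trivial.
- apply (f_equal px) in E; revert E; autorewrite with coords; intros ->; ring.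
- apply (f_equal py) in E; revert E; autorewrite with coords; intros ->; ring.
- apply (f_equal pz) in E; revert E; autorewrite with coords; intros ->; ring.
Qed.

(** * Differentiation of curves *)

Definition has_velocity (c : R -> L3) (s : R) (v : L3) : Prop :=
  is_derive (fun u => px (c u)) s (px v) /\
  is_derive (fun u => py (c u)) s (py v) /\
  is_derive (fun u => pz (c u)) s (pz v).

Lemma D_plus (f g : R -> R) s a b :
  is_derive f s a -> is_derive g s b -> is_derive (fun u => f u + g u) s (a + b).
Proof. intros; now apply (is_derive_plus f g). Qed.

Lemma D_mult (f g : R -> R) s a b :
  is_derive f s a -> is_derive g s b ->
  is_derive (fun u => f u * g u) s (a * g s + f s * b).
Proof. intros; apply (is_derive_mult f g); trivial; exact Rmult_comm. Qed.

Lemma D_opp (f : R -> R) s a : is_derive f s a -> is_derive (fun u => - f u) s (- a).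
Proof. intros; now apply (is_derive_opp f). Qed.

Lemma D_minus (f g : R -> R) s a b :
  is_derive f s a -> is_derive g s b -> is_derive (fun u => f u - g u) s (a - b).
Proof. intros; now apply (is_derive_minus f g). Qed.

Lemma D_const (x s : R) : is_derive (fun _ => x) s 0.
Proof. exact (is_derive_const x s). Qed.

Lemma D_comp_affine (f : R -> R) (x y s a : R) :
  is_derive f (x * s + y) a -> is_derive (fun u => f (x * u + y)) s (x * a).
Proof.
intros H.
apply (is_derive_comp f (fun u => x * u + y) s a x H).
auto_derive; [trivial | ring].
Qed.

Lemma has_velocity_eq c s v w : has_velocity c s v -> v = w -> has_velocity c s w.
Proof. now intros H <-. Qed.

Lemma velocity_unique c s v : has_velocity c s v -> velocity c s = v.
Proof.
intros (H1 & H2 & H3).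
apply L3_ext; cbn; now apply is_derive_unique.
Qed.

Lemma has_velocity_plus c d s v w :
  has_velocity c s v -> has_velocity d s w ->
  has_velocity (fun u => plus (c u) (d u)) s (plus v w).
Proof.
intros (A1 & A2 & A3) (B1 & B2 & B3).
split; [| split]; autorewrite with coords.
- now apply (D_plus (fun u => px (c u)) (fun u => px (d u))).
- now apply (D_plus (fun u => py (c u)) (fun u => py (d u))).
- now apply (D_plus (fun u => pz (c u)) (fun u => pz (d u))).
Qed.

Lemma has_velocity_const x s : has_velocity (fun _ => x) s zero.
Proof. split; [| split]; apply D_const. Qed.

Lemma has_velocity_scal (f : R -> R) c s a v :
  is_derive f s a -> has_velocity c s v ->
  has_velocity (fun u => scal (f u) (c u)) s (plus (scal a (c s)) (scal (f s) v)).
Proof.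
intros A (B1 & B2 & B3).
split; [| split]; autorewrite with coords.
- now apply (D_mult f (fun u => px (c u))).
- now apply (D_mult f (fun u => py (c u))).
- now apply (D_mult f (fun u => pz (c u))).
Qed.

Lemma has_velocity_cscal x c s v :
  has_velocity c s v -> has_velocity (fun u => scal x (c u)) s (scal x v).
Proof.
intros H; eapply has_velocity_eq.
- apply (has_velocity_scal (fun _ => x)); [apply D_const | exact H].
- vector_ring.
Qed.

Lemma has_velocity_lcross c d s v w :
  has_velocity c s v -> has_velocity d s w ->
  has_velocity (fun u => lcross (c u) (d u)) s
    (plus (lcross v (d s)) (lcross (c s) w)).
Proof.
intros (A1 & A2 & A3) (B1 & B2 & B3).
split; [| split]; autorewrite with coords.
- eapply is_derive_ext with (f := fun u => py (c u) * pz (d u) - pz (c u) * py (d u)).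
  { reflexivity. }
  evar_last; [apply D_minus; apply D_mult; eassumption | cbn; ring].
- eapply is_derive_ext with (f := fun u => pz (c u) * px (d u) - px (c u) * pz (d u)).
  { reflexivity. }
  evar_last; [apply D_minus; apply D_mult; eassumption | cbn; ring].
- eapply is_derive_ext with (f := fun u => - (px (c u) * py (d u) - py (c u) * px (d u))).
  { reflexivity. }
  evar_last; [apply D_opp, D_minus; apply D_mult; eassumption | cbn; ring].
Qed.

Lemma is_derive_lprod c d s v w :
  has_velocity c s v -> has_velocity d s w ->
  is_derive (fun u => lprod (c u) (d u)) s (lprod v (d s) + lprod (c s) w).
Proof.
intros (A1 & A2 & A3) (B1 & B2 & B3); unfold lprod.
evar_last.
- apply D_minus; [apply D_plus |]; apply D_mult; eassumption.
- cbn; ring.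
Qed.

Lemma has_velocity_comp_affine c x y s v :
  has_velocity c (x * s + y) v ->
  has_velocity (fun u => c (x * u + y)) s (scal x v).
Proof.
intros (A1 & A2 & A3).
split; [| split]; autorewrite with coords.
- now apply (D_comp_affine (fun u => px (c u))).
- now apply (D_comp_affine (fun u => py (c u))).
- now apply (D_comp_affine (fun u => pz (c u))).
Qed.

Lemma within_open a b s : within a b s -> locally s (within a b).
Proof.
intros H; apply (open_and (fun u : R => Rbar_lt a u) (fun u : R => Rbar_lt u b)); trivial.
- apply open_Rbar_gt.
- apply open_Rbar_lt.
Qed.

Lemma within_convex a b s t u :
  within a b s -> within a b t -> s <= u <= t -> within a b u.
Proof.
intros [H1 _] [_ H2] Hu; split.
- now apply Rbar_lt_le_trans with s.
- now apply Rbar_le_lt_trans with t.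
Qed.

Lemma within_all s : within m_infty p_infty s.
Proof. split; exact I. Qed.

Lemma within_inhabited a b : Rbar_lt a b -> exists s, within a b s.
Proof.
intros H; destruct a as [a | |], b as [b | |]; try easy; cbn in H.
- exists ((a + b) / 2); split; cbn; lra.
- exists (a + 1); split; cbn; lra.
- exists (b - 1); split; cbn; lra.
- exists 0; split; exact I.
Qed.

Lemma within_ind2 (P : R -> R -> Prop) a b :
  (forall s t, within a b s -> within a b t -> s < t -> P s t) ->
  (forall s t, P s t -> P t s) -> (forall s, P s s) ->
  forall s t, within a b s -> within a b t -> P s t.
Proof.
intros H Hsym Hrefl s t Hs Ht.
destruct (Rtotal_order s t) as [L | [-> | L]]; auto.
Qed.

Lemma zero_derivative_constant (f : R -> R) a b s t :
  (forall u, within a b u -> is_derive f u 0) ->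
  within a b s -> within a b t -> f s = f t.
Proof.
intros H; apply (within_ind2 (fun s t => f s = f t)); try congruence.
clear s t; intros s t Hs Ht L.
apply eq_is_derive; trivial.
intros u Hu; apply H; now apply (within_convex a b s t).
Qed.

Lemma zero_velocity_constant (c : R -> L3) a b s t :
  (forall u, within a b u -> has_velocity c u zero) ->
  within a b s -> within a b t -> c s = c t.
Proof.
intros H Hs Ht; apply L3_ext.
- apply (zero_derivative_constant (fun u => px (c u)) a b); trivial; apply H.
- apply (zero_derivative_constant (fun u => py (c u)) a b); trivial; apply H.
- apply (zero_derivative_constant (fun u => pz (c u)) a b); trivial; apply H.
Qed.

Lemma equal_velocity_translate (c d : R -> L3) a b :
  Rbar_lt a b ->
  (forall s, within a b s -> exists v, has_velocity c s v /\ has_velocity d s v) ->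
  exists x : L3, forall s, within a b s -> c s = plus (d s) x.
Proof.
intros L H.
destruct (within_inhabited a b L) as [s0 Hs0].
exists (plus (c s0) (opp (d s0))); intros s Hs.
set (g := fun u => plus (c u) (scal (-1) (d u))).
assert (E : g s = g s0).
{ apply (zero_velocity_constant g a b); trivial.
  intros u Hu; destruct (H u Hu) as (v & Hc & Hd).
  eapply has_velocity_eq.
  - apply has_velocity_plus; [exact Hc | apply has_velocity_cscal, Hd].
  - vector_ring. }
replace (c s) with (plus (d s) (g s)) by (unfold g; vector_ring).
rewrite E; unfold g; vector_ring.
Qed.

Lemma has_velocity_ext_within c d a b s v :
  (forall u, within a b u -> c u = d u) -> within a b s ->
  has_velocity c s v -> has_velocity d s v.
Proof.
intros E Hs (H1 & H2 & H3).
split; [| split]; (eapply is_derive_ext_loc; [| eassumption]);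
  (apply (filter_imp (within a b)); [| now apply within_open]);
  intros u Hu; cbv beta; now rewrite E.
Qed.

(** This is how an identity valid along a whole interval gets differentiated. *)
Lemma zero_derivative_within (f : R -> R) (x l : R) a b s :
  (forall u, within a b u -> f u = x) -> within a b s -> is_derive f s l -> l = 0.
Proof.
intros E Hs H.
rewrite <- (is_derive_unique _ _ _ H).
rewrite (Derive_ext_loc f (fun _ => x)); [apply Derive_const |].
apply (filter_imp (within a b)); [exact E | now apply within_open].
Qed.

Lemma smooth_velocity a b c s :
  smooth_curve a b c -> within a b s -> has_velocity c s (velocity c s).
Proof.
intros Hc Hs; destruct (Hc 1%nat s Hs) as (H1 & H2 & H3).
split; [| split]; now apply Derive_correct.
Qed.

Lemma smooth_acceleration a b c s :
  smooth_curve a b c ->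
  within a b s -> has_velocity (velocity c) s (acceleration c s).
Proof.
intros Hc Hs; destruct (Hc 2%nat s Hs) as (H1 & H2 & H3).
split; [| split]; now apply Derive_correct.
Qed.

Lemma smooth_jerk a b c s :
  smooth_curve a b c ->
  within a b s -> has_velocity (acceleration c) s (velocity (acceleration c) s).
Proof.
intros Hc Hs; destruct (Hc 3%nat s Hs) as (H1 & H2 & H3).
split; [| split]; now apply Derive_correct.
Qed.

(** * Rotations about an axis of arbitrary causal character *)

(** These functions play the role of sin and 1 - cos, scaled so that the formulas
    are uniform in the sign of la, which will be <e,e>: then 1 + sn A + cn A^2
    is exp (s A) whenever A^3 = la A. *)
Definition flow_coefficients (la : R) (sn cn : R -> R) : Prop :=
  (forall s, is_derive sn s (1 + la * cn s)) /\
  (forall s, is_derive cn s (sn s)) /\ sn 0 = 0 /\ cn 0 = 0.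

(** The relation cos^2 + sin^2 = 1 or cosh^2 - sinh^2 = 1 in a form that keeps a
    meaning for la = 0. *)
Lemma flow_coefficients_conic la sn cn :
  flow_coefficients la sn cn ->
  forall s, sn s * sn s = 2 * cn s + la * (cn s * cn s).
Proof.
intros (Hs & Hc & Es & Ec) s.
assert (H : forall u,
  is_derive (fun s => sn s * sn s - (2 * cn s + la * (cn s * cn s))) u 0).
{ intros u; evar_last.
  - apply D_minus; [apply D_mult; apply Hs |].
    apply D_plus; (apply D_mult; [apply D_const |]); [apply Hc |].
    apply D_mult; apply Hc.
  - cbn; ring. }
assert (E := zero_derivative_constant _ m_infty p_infty s 0
  (fun u _ => H u) (within_all s) (within_all 0)).
cbv beta in E; rewrite Es, Ec in E; lra.
Qed.

(** For la > 0 the conic is a hyperbola, and y >= 0 singles out the branch through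
    the origin. *)
Definition parametrizes_conic (la : R) (sn cn : R -> R) : Prop :=
  forall x y, x * x = 2 * y + la * (y * y) -> (0 < la -> 0 <= y) ->
    exists s, sn s = x /\ cn s = y.

Lemma flow_coefficients_hyperbolic la : 0 < la ->
  exists sn cn dn, flow_coefficients la sn cn /\
    (forall s, is_derive dn s (cn s)) /\ parametrizes_conic la sn cn.
Proof.
intros L.
set (w := sqrt la).
assert (W : 0 < w) by now apply sqrt_lt_R0.
assert (E : w * w = la) by (apply sqrt_sqrt; lra).
set (sn := fun s => (exp (w * s) - exp (- (w * s))) / (2 * w)).
set (cn := fun s => ((exp (w * s) + exp (- (w * s))) / 2 - 1) / la).
exists sn, cn, (fun s => / la * (sn s - s)).
assert (Hs : forall s, is_derive sn s (1 + la * cn s)).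
{ intros s; unfold sn, cn; auto_derive; [lra | field; lra]. }
split; [repeat apply conj |split].
- exact Hs.
- intros s; unfold sn, cn; auto_derive; [lra | rewrite <- E; field; lra].
- unfold sn; rewrite Rmult_0_r, Ropp_0, exp_0; field; lra.
- unfold cn; rewrite Rmult_0_r, Ropp_0, exp_0; field; lra.
- intros s; evar_last.
  + apply D_mult; [apply D_const | apply D_minus; [apply Hs | apply is_derive_id]].
  + cbn; field; lra.
- intros x y H Hy.
  specialize (Hy L).
  (* In the coordinates 1 + la y and w x the branch is cosh, sinh. *)
  assert (HXY : (1 + la * y + w * x) * (1 + la * y - w * x) = 1) by
    (rewrite <- E in *; nra).
  assert (P1 : 0 <= la * y) by now apply Rmult_le_pos; [apply Rlt_le |].
  assert (P : 0 < 1 + la * y + w * x).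
  { destruct (Rlt_or_le 0 (1 + la * y + w * x)); [assumption | nra]. }
  assert (HV : / (1 + la * y + w * x) = 1 + la * y - w * x).
  { apply (Rmult_eq_reg_l (1 + la * y + w * x)); [| lra].
    rewrite HXY; field; lra. }
  exists (ln (1 + la * y + w * x) / w).
  unfold sn, cn.
  replace (w * (ln (1 + la * y + w * x) / w)) with (ln (1 + la * y + w * x))
    by (field; lra).
  rewrite exp_Ropp, (exp_ln _ P), HV; split; field; lra.
Qed.

Lemma unit_circle_angle x y :
  x * x + y * y = 1 -> exists a, cos a = x /\ sin a = y.
Proof.
intros H.
assert (B : -1 <= x <= 1) by (split; nra).
assert (C := cos_acos x B); assert (S := sin_acos x B).
assert (HS : sqrt (1 - x²) = Rabs y).
{ rewrite <- sqrt_Rsqr_abs; f_equal; unfold Rsqr; lra. }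
rewrite HS in S.
destruct (Rle_or_lt 0 y) as [P | P].
- exists (acos x); split; trivial.
  now rewrite S, Rabs_pos_eq.
- exists (- acos x); rewrite cos_neg, sin_neg, S, Rabs_left; trivial.
  split; [trivial | ring].
Qed.

Lemma flow_coefficients_elliptic la : la < 0 ->
  exists sn cn dn, flow_coefficients la sn cn /\
    (forall s, is_derive dn s (cn s)) /\ parametrizes_conic la sn cn.
Proof.
intros L.
set (w := sqrt (- la)).
assert (W : 0 < w) by (apply sqrt_lt_R0; lra).
assert (E : w * w = - la) by (apply sqrt_sqrt; lra).
set (sn := fun s => sin (w * s) / w).
set (cn := fun s => (cos (w * s) - 1) / la).
exists sn, cn, (fun s => / la * (sn s - s)).
assert (Hs : forall s, is_derive sn s (1 + la * cn s)).
{ intros s; unfold sn, cn; auto_derive; [lra | field; lra]. }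
split; [repeat apply conj |split].
- exact Hs.
- intros s; unfold sn, cn; auto_derive; [lra |].
  replace la with (- (w * w)) by lra; field; lra.
- unfold sn; rewrite Rmult_0_r, sin_0; field; lra.
- unfold cn; rewrite Rmult_0_r, cos_0; field; lra.
- intros s; evar_last.
  + apply D_mult; [apply D_const | apply D_minus; [apply Hs | apply is_derive_id]].
  + cbn; field; lra.
- intros x y H _.
  destruct (unit_circle_angle (1 + la * y) (w * x)) as (a & Ca & Sa).
  { replace ((1 + la * y) * (1 + la * y) + w * x * (w * x))
      with (1 + la * (2 * y + la * (y * y)) + (w * w) * (x * x)) by ring.
    rewrite H, E; ring. }
  exists (a / w); unfold sn, cn.
  replace (w * (a / w)) with a by (field; lra).
  rewrite Ca, Sa; split; field; lra.
Qed.

Lemma flow_coefficients_parabolic :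
  exists sn cn dn, flow_coefficients 0 sn cn /\
    (forall s, is_derive dn s (cn s)) /\ parametrizes_conic 0 sn cn.
Proof.
exists (fun s => s), (fun s => s * s / 2), (fun s => s * s * s / 6).
split; [repeat apply conj |split].
- intros s; auto_derive; [trivial | lra].
- intros s; auto_derive; [trivial | field].
- reflexivity.
- field.
- intros s; auto_derive; [trivial | field].
- intros x y H _; exists x; split; lra.
Qed.

Lemma flow_coefficients_exist la :
  exists sn cn dn, flow_coefficients la sn cn /\
    (forall s, is_derive dn s (cn s)) /\ parametrizes_conic la sn cn.
Proof.
destruct (Rtotal_order la 0) as [L | [-> | L]].
- now apply flow_coefficients_elliptic.
- exact flow_coefficients_parabolic.
- now apply flow_coefficients_hyperbolic.
Qed.

Definition rotating (a b : Rbar) (e : L3) (T : R -> L3) : Prop :=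
  forall s, within a b s -> has_velocity T s (lcross e (T s)).

Definition flow (e : L3) (sn cn : R) (x : L3) : L3 :=
  plus x (plus (scal sn (lcross e x)) (scal cn (lcross e (lcross e x)))).

(** (1 + sn A + cn A^2) (1 - sn A + cn A^2) = 1 + (2 cn + la cn^2 - sn^2) A^2,
    because A^4 = la A^2. *)
Lemma flow_inverse e sn cn x :
  sn * sn = 2 * cn + lprod e e * (cn * cn) ->
  flow e sn cn (flow e (- sn) cn x) = x.
Proof.
intros H.
assert (E : flow e sn cn (flow e (- sn) cn x)
  = plus x (scal (2 * cn + lprod e e * (cn * cn) - sn * sn)
              (lcross e (lcross e x)))) by (unfold flow; vector_ring).
rewrite E, H; vector_ring.
Qed.

(** Applying the inverse flow to a solution gives a constant curve; this yields
    existence of a formula and uniqueness at the same time, and is valid for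
    every causal character of e, where no positive definite energy is at hand. *)
Lemma rotating_flow a b e T sn cn s0 s :
  flow_coefficients (lprod e e) sn cn -> rotating a b e T ->
  within a b s0 -> within a b s ->
  T s = flow e (sn (s - s0)) (cn (s - s0)) (T s0).
Proof.
intros F HT Hs0 Hs.
assert (Con := flow_coefficients_conic _ _ _ F).
destruct F as (Fs & Fc & Es & Ec).
set (P := fun u => plus (T u) (plus
  (scal (- sn (1 * u + - s0)) (lcross e (T u)))
  (scal (cn (1 * u + - s0)) (lcross e (lcross e (T u)))))).
assert (E : P s = P s0).
{ apply (zero_velocity_constant P a b); trivial.
  intros u Hu.
  assert (H1 : has_velocity (fun u => lcross e (T u)) u (lcross e (lcross e (T u)))).
  { eapply has_velocity_eq.
    - apply has_velocity_lcross; [apply has_velocity_const | now apply HT].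
    - vector_ring. }
  assert (H2 : has_velocity (fun u => lcross e (lcross e (T u))) u
    (scal (lprod e e) (lcross e (T u)))).
  { eapply has_velocity_eq.
    - apply has_velocity_lcross; [apply has_velocity_const | exact H1].
    - vector_ring. }
  eapply has_velocity_eq.
  - apply has_velocity_plus; [now apply HT |].
    apply has_velocity_plus; (apply has_velocity_scal; [| eassumption]).
    + apply D_opp, D_comp_affine, Fs.
    + apply D_comp_affine, Fc.
  - vector_ring. }
assert (E0 : P s0 = T s0).
{ unfold P; replace (1 * s0 + - s0) with 0 by ring.
  rewrite Es, Ec; vector_ring. }
rewrite <- E0, <- E.
replace (P s) with (flow e (- sn (s - s0)) (cn (s - s0)) (T s)).
- symmetry; apply flow_inverse, Con.
- unfold P, flow; replace (1 * s + - s0) with (s - s0) by ring; reflexivity.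
Qed.

Lemma rotating_unique a b e T U s0 :
  rotating a b e T -> rotating a b e U -> within a b s0 -> T s0 = U s0 ->
  forall s, within a b s -> T s = U s.
Proof.
intros HT HU Hs0 E s Hs.
destruct (flow_coefficients_exist (lprod e e)) as (sn & cn & _ & F & _).
rewrite (rotating_flow a b e T sn cn s0 s), (rotating_flow a b e U sn cn s0 s),
  E; trivial.
Qed.

Lemma rotating_height a b e T s0 s :
  rotating a b e T -> within a b s0 -> within a b s ->
  lprod e (T s) = lprod e (T s0).
Proof.
intros HT Hs0 Hs.
apply (zero_derivative_constant (fun u => lprod e (T u)) a b); trivial.
intros u Hu; evar_last.
- apply is_derive_lprod; [apply has_velocity_const | now apply HT].
- autorewrite with bilinear; apply Rplus_0_l.
Qed.

Lemma rotating_norm a b e T s0 s :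
  rotating a b e T -> within a b s0 -> within a b s ->
  lprod (T s) (T s) = lprod (T s0) (T s0).
Proof.
intros HT Hs0 Hs.
apply (zero_derivative_constant (fun u => lprod (T u) (T u)) a b); trivial.
intros u Hu; evar_last.
- apply is_derive_lprod; now apply HT.
- autorewrite with bilinear; apply Rplus_0_l.
Qed.

(** V - T is orthogonal to e, and e x T, e x (e x T) span the orthogonal complement
    of e; the coordinates x, y are read off from the products of V with T and
    e x T, and the conic is the equation <V,V> = <T,T> in these coordinates. *)
Lemma level_set_coordinates e T V tau :
  lprod T T = 1 -> lprod V V = 1 -> lprod e T = tau -> lprod e V = tau ->
  tau * tau - lprod e e <> 0 ->
  exists x y, V = flow e x y T /\
    x * x = 2 * y + lprod e e * (y * y) /\
    lprod T V = 1 - y * (tau * tau - lprod e e).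
Proof.
intros HT HV eT eV Hq.
set (la := lprod e e) in *; set (q := tau * tau - la) in *.
assert (HN : lprod (lcross e T) (lcross e T) = q).
{ rewrite lagrange_identity, (lprod_sym T e), eT, HT; unfold q, la; ring. }
assert (H2 : lcross e (lcross e T) = plus (scal la T) (scal (- tau) e))
  by now rewrite lcross_lcross, eT.
set (x := lprod V (lcross e T) / q).
set (y := (1 - lprod T V) / q).
assert (EV : V = flow e x y T).
{ assert (Z : plus V (opp (flow e x y T)) = zero).
  { apply (orthogonal_to_frame e T).
    - now rewrite HN.
    - unfold flow; rewrite H2; autorewrite with bilinear.
      rewrite (lprod_sym V e), (lprod_sym T e), eT, eV; fold la; ring.
    - unfold flow; rewrite H2; autorewrite with bilinear.
      rewrite HT, eT, (lprod_sym V T); unfold y, q; field; exact Hq.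
    - unfold flow; rewrite H2; autorewrite with bilinear.
      rewrite HN; unfold x; field; exact Hq. }
  replace V with (plus (flow e x y T) (plus V (opp (flow e x y T))))
    by vector_ring.
  rewrite Z; vector_ring. }
exists x, y; repeat apply conj; trivial.
- assert (E : lprod V V = 1) by trivial.
  rewrite EV in E; unfold flow in E; rewrite H2 in E.
  revert E; autorewrite with bilinear.
  rewrite HN, HT, (lprod_sym T e), eT; fold la.
  intros E; apply (Rmult_eq_reg_l q); trivial.
  unfold q in *; nra.
- unfold y; field; exact Hq.
Qed.

(** The last hypothesis says that V lies on the same branch as G s0 when the level
    set is a hyperbola: it is y >= 0 in the coordinates of
    [level_set_coordinates]. *)
Lemma rotating_orbit e G V tau s0 :
  rotating m_infty p_infty e G ->
  lprod (G s0) (G s0) = 1 -> lprod V V = 1 ->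
  lprod e (G s0) = tau -> lprod e V = tau ->
  tau * tau - lprod e e <> 0 ->
  (0 < lprod e e -> 0 <= (1 - lprod (G s0) V) * (tau * tau - lprod e e)) ->
  exists s, G s = V.
Proof.
intros HG N1 N2 E1 E2 Hq Hp.
destruct (level_set_coordinates e (G s0) V tau) as (x & y & -> & C & P); trivial.
destruct (flow_coefficients_exist (lprod e e)) as (sn & cn & _ & F & _ & On).
destruct (On x y C) as (s & <- & <-).
{ intros L; specialize (Hp L); rewrite P in Hp.
  assert (0 < (tau * tau - lprod e e) * (tau * tau - lprod e e)).
  { apply Rsqr_pos_lt; exact Hq. }
  nra. }
exists (s + s0).
rewrite (rotating_flow m_infty p_infty e G sn cn s0); trivial using within_all.
now replace (s + s0 - s0) with s by ring.
Qed.

(** * Helices are the curves whose velocity rotates about a fixed axis *)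

Lemma acceleration_norm_constant a b c s :
  frenet_type a b c -> (exists k, forall s, within a b s -> curvature c s = k) ->
  within a b s ->
  exists q, q <> 0 /\
    forall u, within a b u -> lprod (acceleration c u) (acceleration c u) = q.
Proof.
intros HF (k & Hk) Hs.
assert (Sq : forall u, within a b u ->
  Rabs (lprod (acceleration c u) (acceleration c u)) = k * k).
{ intros u Hu; rewrite <- (Hk u Hu); unfold curvature.
  symmetry; apply sqrt_sqrt, Rabs_pos. }
destruct HF as [HF | HF].
- exists (k * k); split.
  + rewrite <- (Sq s Hs), Rabs_pos_eq; specialize (HF s Hs); lra.
  + intros u Hu; rewrite <- (Sq u Hu), Rabs_pos_eq; specialize (HF u Hu); lra.
- exists (- (k * k)); split.
  + rewrite <- (Sq s Hs), Rabs_left; specialize (HF s Hs); lra.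
  + intros u Hu; rewrite <- (Sq u Hu), Rabs_left; specialize (HF u Hu); lra.
Qed.

(** The axis e = tau T - T x T' is constant: e' = tau T' - T x T'' is orthogonal
    to T; its product with T' vanishes by the definition of the torsion tau,
    which says det (T, T', T'') = - tau <T',T'>; its product with T x T' is
    <T',T''> = 0, by constancy of the curvature. *)
Lemma helix_rotates a b c :
  Rbar_lt a b -> circular_helix a b c ->
  exists e tau, tau <> 0 /\ tau * tau - lprod e e <> 0 /\
    rotating a b e (velocity c) /\
    forall s, within a b s -> lprod e (velocity c s) = tau.
Proof.
intros L (Sm & Un & HF & HC & tau & Ht & HT).
destruct (within_inhabited a b L) as [s0 Hs0].
destruct (acceleration_norm_constant a b c s0 HF HC Hs0) as (q & Hq & Hqq).
set (T := velocity c) in *; set (A := acceleration c) in *.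
set (J := velocity A).
change (forall s, within a b s -> lprod (T s) (T s) = 1) in Un.
assert (DT : forall s, within a b s -> has_velocity T s (A s))
  by (intros; now apply (smooth_acceleration a b)).
assert (DA : forall s, within a b s -> has_velocity A s (J s))
  by (intros; now apply (smooth_jerk a b)).
assert (TA : forall s, within a b s -> lprod (T s) (A s) = 0).
{ intros s Hs.
  assert (E := zero_derivative_within _ 1 _ a b s Un Hs
    (is_derive_lprod _ _ _ _ _ (DT s Hs) (DT s Hs))).
  rewrite (lprod_sym (A s)) in E; lra. }
assert (AJ : forall s, within a b s -> lprod (A s) (J s) = 0).
{ intros s Hs.
  assert (E := zero_derivative_within _ q _ a b s Hqq Hs
    (is_derive_lprod _ _ _ _ _ (DA s Hs) (DA s Hs))).
  rewrite (lprod_sym (J s)) in E; lra. }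
set (k := sqrt (Rabs q)).
assert (Ck : forall s, within a b s -> curvature c s = k).
{ intros s Hs; unfold curvature; fold A; now rewrite Hqq. }
assert (Kp : 0 < k) by now apply sqrt_lt_R0, Rabs_pos_lt.
assert (det : forall s, within a b s ->
  lprod (J s) (lcross (T s) (A s)) = - tau * q).
{ intros s Hs.
  assert (DN : velocity (principal_normal c) s = scal (/ k) (J s)).
  { apply velocity_unique.
    apply (has_velocity_ext_within (fun u => scal (/ k) (A u)) _ a b s).
    - intros u Hu; unfold principal_normal; fold A; now rewrite Ck.
    - exact Hs.
    - now apply has_velocity_cscal, DA. }
  assert (B : binormal c s = scal (/ k) (lcross (T s) (A s))).
  { unfold binormal, principal_normal; rewrite (Ck s Hs); fold T A.
    vector_ring. }
  assert (E := HT s Hs); unfold torsion in E.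
  rewrite DN, B in E; revert E; autorewrite with bilinear.
  rewrite lagrange_identity, (Hqq s Hs), (Un s Hs), (lprod_sym (A s)), (TA s Hs).
  intros <-; field; split; [lra | exact Hq]. }
set (E := fun s => plus (scal tau (T s)) (scal (-1) (lcross (T s) (A s)))).
assert (Econst : forall s, within a b s -> E s = E s0).
{ intros s Hs; apply (zero_velocity_constant E a b); trivial.
  clear s Hs; intros s Hs.
  eapply has_velocity_eq.
  - apply has_velocity_plus; apply has_velocity_cscal; [now apply DT |].
    apply has_velocity_lcross; [now apply DT | now apply DA].
  - replace (lcross (A s) (A s)) with (zero : L3) by vector_ring.
    apply (orthogonal_to_frame (T s) (A s)).
    + now rewrite lagrange_identity, (Hqq s Hs), (Un s Hs), (lprod_sym (A s)),
        (TA s Hs), !Rmult_0_l, Rminus_0_l, Rmult_1_l; apply Ropp_neq_0_compat.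
    + autorewrite with bilinear; rewrite (lprod_sym (A s)), (TA s Hs); ring.
    + autorewrite with bilinear; rewrite (Hqq s Hs).
      replace (lprod (lcross (T s) (J s)) (A s))
        with (- lprod (J s) (lcross (T s) (A s))) by scalar_ring.
      rewrite (det s Hs); ring.
    + autorewrite with bilinear.
      rewrite !lagrange_identity, (TA s Hs), (lprod_sym (J s) (A s)), (AJ s Hs); ring. }
exists (E s0), tau; split; [exact Ht |].
assert (H : lprod (E s0) (E s0) = tau * tau - q).
{ unfold E; autorewrite with bilinear.
  rewrite lagrange_identity, (Hqq _ Hs0), (Un _ Hs0), (lprod_sym (A s0)),
    (TA _ Hs0); ring. }
split; [lra |]; split.
- intros s Hs; eapply has_velocity_eq; [now apply DT |].
  rewrite <- (Econst s Hs).
  replace (lcross (E s) (T s)) with (lcross (T s) (lcross (T s) (A s)))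
    by (unfold E; vector_ring).
  rewrite lcross_lcross, (Un s Hs), (TA s Hs); vector_ring.
- intros s Hs; rewrite <- (Econst s Hs); unfold E; autorewrite with bilinear.
  rewrite (Un s Hs); ring.
Qed.

Lemma rotating_acceleration a b e c T s :
  (forall s, within a b s -> has_velocity c s (T s)) -> rotating a b e T ->
  within a b s -> acceleration c s = lcross e (T s).
Proof.
intros Hc HT Hs; apply velocity_unique.
apply (has_velocity_ext_within T _ a b); trivial.
- intros u Hu; symmetry; now apply velocity_unique, Hc.
- now apply HT.
Qed.

(** Every derivative of f is again a height <w,T>, since <w, e x T> = <w x e, T>. *)
Lemma rotating_primitive_smooth a b e T f w :
  rotating a b e T -> (forall s, within a b s -> is_derive f s (lprod w (T s))) ->
  forall n s, within a b s -> ex_derive_n f n s.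
Proof.
intros HT Hf.
assert (H : forall n, exists w', forall s, within a b s ->
  is_derive (Derive_n f n) s (lprod w' (T s))).
{ induction n as [| n (w' & IH)].
  - now exists w.
  - exists (lcross w' e); intros s Hs.
    apply (is_derive_ext_loc (fun u => lprod w' (T u))).
    + apply (filter_imp (within a b)); [| now apply within_open].
      intros u Hu; symmetry; now apply is_derive_unique, IH.
    + evar_last.
      * apply is_derive_lprod; [apply has_velocity_const | now apply HT].
      * scalar_ring. }
intros [| n] s Hs; [exact I |].
destruct (H n) as (w' & Hw); eexists; now apply Hw.
Qed.

Lemma rotating_helix a b e c T tau :
  (forall s, within a b s -> has_velocity c s (T s)) -> rotating a b e T ->
  (forall s, within a b s -> lprod (T s) (T s) = 1) ->
  (forall s, within a b s -> lprod e (T s) = tau) ->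
  tau <> 0 -> tau * tau - lprod e e <> 0 ->
  circular_helix a b c /\ (forall s, within a b s -> axis_vector c s = e) /\
  forall s, within a b s ->
    lprod (acceleration c s) (acceleration c s) = tau * tau - lprod e e.
Proof.
intros Hc HT Un Ht Hn; set (q := tau * tau - lprod e e); intros Hq.
assert (V : forall s, within a b s -> velocity c s = T s)
  by (intros; now apply velocity_unique, Hc).
assert (A : forall s, within a b s -> acceleration c s = lcross e (T s))
  by (intros; now apply (rotating_acceleration a b)).
assert (AA : forall s, within a b s ->
  lprod (acceleration c s) (acceleration c s) = q).
{ intros s Hs; rewrite (A s Hs), lagrange_identity, (lprod_sym (T s) e),
    (Ht s Hs), (Un s Hs); unfold q; ring. }
set (k := sqrt (Rabs q)).
assert (Ck : forall s, within a b s -> curvature c s = k).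
{ intros s Hs; unfold curvature; now rewrite AA. }
assert (Kp : 0 < k) by now apply sqrt_lt_R0, Rabs_pos_lt.
assert (B : forall s, within a b s ->
  binormal c s = scal (/ k) (plus (scal tau (T s)) (opp e))).
{ intros s Hs; unfold binormal, principal_normal.
  rewrite (V s Hs), (A s Hs), (Ck s Hs).
  replace (lcross (T s) (scal (/ k) (lcross e (T s))))
    with (scal (/ k) (lcross (T s) (lcross e (T s)))) by vector_ring.
  rewrite lcross_lcross, (Un s Hs), (lprod_sym (T s)), (Ht s Hs).
  f_equal; vector_ring. }
assert (To : forall s, within a b s -> torsion c s = tau).
{ intros s Hs; unfold torsion.
  assert (DN : velocity (principal_normal c) s
    = scal (/ k) (lcross e (lcross e (T s)))).
  { apply velocity_unique.
    apply (has_velocity_ext_within (fun u => scal (/ k) (lcross e (T u))) _ a b s).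
    - intros u Hu; unfold principal_normal; now rewrite Ck, A.
    - exact Hs.
    - apply has_velocity_cscal; eapply has_velocity_eq.
      + apply has_velocity_lcross; [apply has_velocity_const | now apply HT].
      + vector_ring. }
  rewrite DN, (B s Hs), lcross_lcross, (Ht s Hs).
  autorewrite with bilinear.
  rewrite (Un s Hs), (lprod_sym (T s)), (Ht s Hs); unfold q in *.
  field; split; [| lra].
  intros Z; apply Hq; lra. }
repeat apply conj.
(* Coordinates are heights; the metric puts a sign on the third one. *)
- intros n s Hs; split; [| split].
  + apply (rotating_primitive_smooth a b e T _ (1, 0, 0)); trivial.
    intros u Hu; evar_last; [apply (Hc u Hu) | unfold lprod; cbn; ring].
  + apply (rotating_primitive_smooth a b e T _ (0, 1, 0)); trivial.
    intros u Hu; evar_last; [apply (Hc u Hu) | unfold lprod; cbn; ring].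
  + apply (rotating_primitive_smooth a b e T _ (0, 0, -1)); trivial.
    intros u Hu; evar_last; [apply (Hc u Hu) | unfold lprod; cbn; ring].
- intros s Hs; rewrite (V s Hs); now apply Un.
- destruct (Rdichotomy _ _ Hq) as [L | L]; [right | left];
    intros s Hs; now rewrite AA.
- now exists k.
- now exists tau.
- intros s Hs; unfold axis_vector.
  rewrite (To s Hs), (V s Hs), (Ck s Hs), (B s Hs).
  apply L3_ext; autorewrite with coords; field; lra.
- exact AA.
Qed.

(** An arc of a helix extends to the full helix, the flow being complete. *)
Lemma rotating_extension a b e c T :
  Rbar_lt a b ->
  (forall s, within a b s -> has_velocity c s (T s)) -> rotating a b e T ->
  exists ga G, (forall s, has_velocity ga s (G s)) /\
    rotating m_infty p_infty e G /\
    (forall s, within a b s -> c s = ga s) /\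
    (forall s, within a b s -> T s = G s).
Proof.
intros L Hc HT.
destruct (within_inhabited a b L) as [s0 Hs0].
destruct (flow_coefficients_exist (lprod e e)) as (sn & cn & dn & F & D & _).
set (G := fun s => flow e (sn (1 * s + - s0)) (cn (1 * s + - s0)) (T s0)).
assert (EG : forall s, within a b s -> T s = G s).
{ intros s Hs; unfold G; replace (1 * s + - s0) with (s - s0) by ring.
  now apply (rotating_flow a b). }
destruct F as (Fs & Fc & _).
assert (HG : rotating m_infty p_infty e G).
{ intros s _; eapply has_velocity_eq.
  - apply has_velocity_plus; [apply has_velocity_const |].
    apply has_velocity_plus; (apply has_velocity_scal; [| apply has_velocity_const]);
      apply D_comp_affine; [apply Fs | apply Fc].
  - unfold G, flow; vector_ring. }
set (p := fun s => plus (scal (1 * s + - s0) (T s0)) (plus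
  (scal (cn (1 * s + - s0)) (lcross e (T s0)))
  (scal (dn (1 * s + - s0)) (lcross e (lcross e (T s0)))))).
assert (Hp : forall s, has_velocity p s (G s)).
{ intros s; eapply has_velocity_eq.
  - apply has_velocity_plus; [| apply has_velocity_plus];
      (apply has_velocity_scal; [| apply has_velocity_const]).
    + apply (D_comp_affine (fun u => u)), is_derive_id.
    + apply D_comp_affine, Fc.
    + apply D_comp_affine, D.
  - unfold G, flow.
    apply L3_ext; autorewrite with coords; unfold one; cbn; ring. }
destruct (equal_velocity_translate c p a b L) as (x & Hx).
{ intros s Hs; exists (T s); split; [now apply Hc |].
  rewrite (EG s Hs); apply Hp. }
exists (fun s => plus (p s) x), G; repeat apply conj; trivial.
intros s; eapply has_velocity_eq.
- apply has_velocity_plus; [apply Hp | apply has_velocity_const].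
- vector_ring.
Qed.

(** * The second generating curve *)

(** Here U and U' are the velocity and acceleration of the second curve at one
    point. As functions of s, <T,D> is the constant - <e,U> for
    D = U x U' - tau U; its first derivative gives <e x T, D> = 0 and the second
    one <e,D>. These three products are those of - (<e,U>/tau) e. *)
Lemma maximality_forces_rotation a b e T tau U U' :
  Rbar_lt a b -> rotating a b e T ->
  (forall s, within a b s -> lprod (T s) (T s) = 1) ->
  (forall s, within a b s -> lprod e (T s) = tau) ->
  tau <> 0 -> tau * tau - lprod e e <> 0 ->
  lprod U U = 1 -> lprod U U' = 0 ->
  (forall s, within a b s ->
     lprod (lcross (T s) U) (plus (lcross e (T s)) U') = 0) ->
  lprod e U * lprod e U = tau * tau /\
  U' = scal (lprod e U / tau) (lcross e U).
Proof.
intros L HT Un Ht Hn Hq UU UU' HM.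
destruct (within_inhabited a b L) as [s Hs].
set (m := lprod e U) in *.
set (D := plus (lcross U U') (scal (- tau) U)).
assert (D0 : forall u, within a b u -> lprod (T u) D = - m).
{ intros u Hu; assert (E := HM u Hu); revert E; unfold D.
  autorewrite with bilinear.
  rewrite lagrange_identity, (lprod_sym (T u) e), (lprod_sym U e),
    (lprod_sym U (T u)), (Ht u Hu), (Un u Hu).
  replace (lprod (lcross (T u) U) U') with (lprod (T u) (lcross U U')) by scalar_ring.
  fold m; lra. }
assert (D1 : forall u, within a b u -> lprod (lcross e (T u)) D = 0).
{ intros u Hu; eapply (zero_derivative_within _ _ _ a b u D0 Hu).
  evar_last; [apply is_derive_lprod; [now apply HT | apply has_velocity_const] |].
  scalar_ring. }
assert (D2 : lprod (lcross e (lcross e (T s))) D = 0).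
{ eapply (zero_derivative_within _ _ _ a b s D1 Hs).
  evar_last; [apply is_derive_lprod; [apply has_velocity_lcross;
    [apply has_velocity_const | now apply HT] | apply has_velocity_const] |].
  scalar_ring. }
rewrite lcross_lcross, (Ht s Hs) in D2; revert D2.
autorewrite with bilinear; rewrite (D0 s Hs); intros D2.
assert (Z : plus D (scal (m / tau) e) = zero).
{ apply (orthogonal_to_frame e (T s)).
  - rewrite lagrange_identity, (lprod_sym (T s) e), (Ht s Hs), (Un s Hs); lra.
  - autorewrite with bilinear; rewrite (lprod_sym D).
    apply (Rmult_eq_reg_l tau); trivial.
    replace (tau * (lprod e D + m / tau * lprod e e))
      with (tau * lprod e D + m * lprod e e) by (field; trivial).
    lra.
  - autorewrite with bilinear.
    rewrite (lprod_sym D), (D0 s Hs), (Ht s Hs); field; trivial.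
  - autorewrite with bilinear; rewrite (lprod_sym D), (D1 s Hs); ring. }
assert (W : lcross U U' = plus (scal tau U) (scal (- (m / tau)) e)).
{ replace (lcross U U') with
    (plus (plus D (scal (m / tau) e)) (plus (scal tau U) (scal (- (m / tau)) e)))
    by (unfold D; vector_ring).
  rewrite Z; vector_ring. }
split.
- assert (E : lprod (lcross U U') U = 0) by apply lcross_ll.
  rewrite W in E; revert E; autorewrite with bilinear; rewrite UU; fold m.
  intros E; apply (Rmult_eq_reg_l (/ tau)); [| now apply Rinv_neq_0_compat].
  replace (/ tau * (tau * tau)) with tau by (field; trivial).
  unfold Rdiv in E; lra.
- assert (E : lcross U (lcross U U') = U').
  { rewrite lcross_lcross, UU, UU'; vector_ring. }
  rewrite <- E, W; vector_ring.
Qed.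

(** t |-> si H(si t + s0) rotates about si e, hence is U as soon as it is so at one
    point; H c = si U(t0) dictates the phase s0. *)
Lemma arc_of_rotating a b be U si e h H t0 c :
  Rbar_lt a b ->
  (forall t, within a b t -> has_velocity be t (U t)) ->
  rotating a b (scal si e) U -> si * si = 1 ->
  (forall s, has_velocity h s (H s)) -> rotating m_infty p_infty e H ->
  within a b t0 -> H c = scal si (U t0) ->
  arc_of_translate a b be h.
Proof.
intros L HB HU Hsi Hh HH Ht0 Hc.
set (s0 := c - si * t0).
assert (E : forall t, within a b t -> U t = scal si (H (si * t + s0))).
{ apply (rotating_unique a b (scal si e) U _ t0 HU); trivial.
  - intros t Ht; eapply has_velocity_eq.
    + apply has_velocity_cscal, has_velocity_comp_affine, HH, within_all.
    + vector_ring.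
  - unfold s0; replace (si * t0 + (c - si * t0)) with c by ring.
    rewrite Hc; apply L3_ext; autorewrite with coords;
      rewrite <- Rmult_assoc, Hsi; ring. }
destruct (equal_velocity_translate be (fun t => h (si * t + s0)) a b L)
  as (v & Hv).
{ intros t Ht; exists (U t); split; [now apply HB |].
  rewrite (E t Ht); apply has_velocity_comp_affine, Hh. }
exists v, si, s0; split; [| exact Hv].
assert (P : (si - 1) * (si + 1) = 0) by lra.
destruct (Rmult_integral _ _ P); [left | right]; lra.
Qed.

Lemma has_velocity_half_turn e c s v :
  has_velocity c s v -> has_velocity (fun u => half_turn e (c u)) s (half_turn e v).
Proof.
intros H; unfold half_turn.
apply (has_velocity_ext_within (fun u => plus
  (scal (lprod (c u) (scal (2 / lprod e e) e)) e) (scal (-1) (c u)))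
  _ m_infty p_infty s); [| apply within_all |].
- intros u _; autorewrite with bilinear.
  apply L3_ext; autorewrite with coords; unfold Rdiv; ring.
- eapply has_velocity_eq.
  + apply has_velocity_plus; [| apply has_velocity_cscal, H].
    apply has_velocity_scal; [| apply has_velocity_const].
    apply is_derive_lprod; [exact H | apply has_velocity_const].
  + autorewrite with bilinear.
    apply L3_ext; autorewrite with coords; unfold lprod; autorewrite with coords;
      unfold Rdiv; ring.
Qed.

(** A half-turn about e commutes with e x _. *)
Lemma rotating_half_turn e T :
  lprod e e <> 0 -> rotating m_infty p_infty e T ->
  rotating m_infty p_infty e (fun s => half_turn e (T s)).
Proof.
intros He HT s Hs; eapply has_velocity_eq.
- now apply has_velocity_half_turn, HT.
- unfold half_turn; autorewrite with bilinear.
  apply L3_ext; autorewrite with coords; field; exact He.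
Qed.

Lemma half_turn_isometry e x :
  lprod e e <> 0 -> lprod (half_turn e x) (half_turn e x) = lprod x x.
Proof.
intros He; unfold half_turn; autorewrite with bilinear.
rewrite (lprod_sym x e); field; exact He.
Qed.

Lemma half_turn_height e x :
  lprod e e <> 0 -> lprod e (half_turn e x) = lprod e x.
Proof.
intros He; unfold half_turn; autorewrite with bilinear.
rewrite (lprod_sym x e); field; exact He.
Qed.

(** The vector V is the velocity of the second curve at a base point, reversed if
    that curve rotates the other way; it remains to find V on the orbit of the
    velocity of the full helix ga, or on the half-turn of this orbit. *)
Lemma helix_translation_partner a1 b1 al a2 b2 be :
  Rbar_lt a1 b1 -> Rbar_lt a2 b2 -> smooth_curve a2 b2 be ->
  spacelike_unit_speed a2 b2 be ->
  (forall s t, within a1 b1 s -> within a2 b2 t ->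
     -1 < lprod (velocity al s) (velocity be t) < 1) ->
  (forall s t, within a1 b1 s -> within a2 b2 t ->
     lprod (lcross (velocity al s) (velocity be t))
       (plus (acceleration al s) (acceleration be t)) = 0) ->
  circular_helix a1 b1 al -> translate_of_same_helix a1 b1 al a2 b2 be.
Proof.
intros L1 L2 S2 N2 HF HM HC.
destruct (helix_rotates a1 b1 al L1 HC) as (e & tau & Ht & Hq & RT & eT).
destruct HC as (S1 & N1 & _).
set (T := velocity al) in *; set (U := velocity be) in *.
change (forall s, within a1 b1 s -> lprod (T s) (T s) = 1) in N1.
change (forall t, within a2 b2 t -> lprod (U t) (U t) = 1) in N2.
assert (DT : forall s, within a1 b1 s -> has_velocity al s (T s))
  by (intros; now apply (smooth_velocity a1 b1)).
assert (DU : forall t, within a2 b2 t -> has_velocity be t (U t))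
  by (intros; now apply (smooth_velocity a2 b2)).
assert (DU' : forall t, within a2 b2 t -> has_velocity U t (acceleration be t))
  by (intros; now apply (smooth_acceleration a2 b2)).
assert (K : forall t, within a2 b2 t ->
  lprod e (U t) * lprod e (U t) = tau * tau /\
  acceleration be t = scal (lprod e (U t) / tau) (lcross e (U t))).
{ intros t Hu; apply (maximality_forces_rotation a1 b1 e T tau); trivial.
  - now apply N2.
  - assert (E := zero_derivative_within _ 1 _ a2 b2 t N2 Hu
      (is_derive_lprod _ _ _ _ _ (DU' t Hu) (DU' t Hu))).
    rewrite (lprod_sym (acceleration be t)) in E; lra.
  - intros s Hs.
    rewrite <- (rotating_acceleration a1 b1 e al T s); auto. }
destruct (within_inhabited a1 b1 L1) as [s0 Hs0].
destruct (within_inhabited a2 b2 L2) as [t0 Ht0].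
set (si := lprod e (U t0) / tau).
assert (Hsi : si * si = 1).
{ unfold si; replace (lprod e (U t0) / tau * (lprod e (U t0) / tau))
    with (lprod e (U t0) * lprod e (U t0) / (tau * tau)) by (field; trivial).
  rewrite (proj1 (K t0 Ht0)); field; trivial. }
assert (RU : rotating a2 b2 (scal si e) U).
{ assert (M : forall t, within a2 b2 t -> lprod e (U t) = lprod e (U t0)).
  { intros t Hu.
    apply (zero_derivative_constant (fun t => lprod e (U t)) a2 b2); trivial.
    intros u Hv; evar_last.
    - apply is_derive_lprod; [apply has_velocity_const | now apply DU'].
    - rewrite (proj2 (K u Hv)); autorewrite with bilinear; ring. }
  intros t Hu; eapply has_velocity_eq; [now apply DU' |].
  rewrite (proj2 (K t Hu)), (M t Hu); fold si; vector_ring. }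
destruct (rotating_extension a1 b1 e al T L1 DT RT) as (ga & G & DG & RG & Ea & ET).
assert (NG : forall s, lprod (G s) (G s) = 1).
{ intros s; rewrite (rotating_norm m_infty p_infty e G s0 s);
    trivial using within_all.
  rewrite <- (ET s0 Hs0); now apply N1. }
assert (eG : forall s, lprod e (G s) = tau).
{ intros s; rewrite (rotating_height m_infty p_infty e G s0 s);
    trivial using within_all.
  rewrite <- (ET s0 Hs0); now apply eT. }
destruct (rotating_helix m_infty p_infty e ga G tau) as (HH & Hax & Hacc); auto.
set (V := scal si (U t0)).
assert (NV : lprod V V = 1).
{ unfold V; autorewrite with bilinear.
  rewrite (N2 t0 Ht0); lra. }
assert (eV : lprod e V = tau).
{ unfold V; autorewrite with bilinear.
  replace (lprod e (U t0)) with (si * tau) by (unfold si; field; trivial).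
  rewrite <- Rmult_assoc, Hsi; ring. }
assert (p1 : lprod (G s0) V < 1).
{ rewrite <- (ET s0 Hs0); unfold V; autorewrite with bilinear.
  specialize (HF s0 t0 Hs0 Ht0); nra. }
exists ga; split; [exact HH |]; split; [exact Ea |]; split; intros HA;
  specialize (HA 0 (within_all 0)); rewrite (Hacc 0 (within_all 0)) in HA.
- destruct (rotating_orbit e G V tau s0) as (c & Hc); trivial.
  (* q > 0 and <G,V> < 1: same branch. *)
  { intros _; apply Rmult_le_pos; lra. }
  now apply (arc_of_rotating a2 b2 be U si e ga G t0 c).
- rewrite (Hax 0 (within_all 0)).
  assert (Hla : 0 < lprod e e) by nra.
  assert (He : lprod e e <> 0) by lra.
  destruct (rotating_orbit e (fun s => half_turn e (G s)) V tau s0) as (c & Hc);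
    trivial.
  { now apply rotating_half_turn. }
  { now rewrite half_turn_isometry. }
  { now rewrite half_turn_height. }
  { intros _.
    destruct (level_set_coordinates e (G s0) V tau) as (x & y & _ & C & P); trivial.
    unfold half_turn; autorewrite with bilinear.
    rewrite (lprod_sym (G s0) e), eG, eV, P.
    rewrite P in p1; set (la := lprod e e) in *.
    (* <G,V> < 1 puts V on the branch y < 0, that is la y <= -2; the half-turn
       replaces y by - (y + 2 / la). *)
    assert (y0 : y < 0) by nra.
    assert (y2 : la * y <= -2) by nra.
    replace (1 - (2 * tau / la * tau + - (1 - y * (tau * tau - la))))
      with (- ((tau * tau - la) * (y + 2 / la))) by (field; trivial).
    assert (y3 : y + 2 / la <= 0).
    { apply (Rmult_le_reg_l la); trivial.
      replace (la * (y + 2 / la)) with (la * y + 2) by (field; trivial); lra. }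
    assert (sq := Rle_0_sqr (tau * tau - la)); unfold Rsqr in sq; nra. }
  apply (arc_of_rotating a2 b2 be U si e (fun s => half_turn e (ga s))
    (fun s => half_turn e (G s)) t0 c); trivial.
  + intros s; now apply has_velocity_half_turn.
  + now apply rotating_half_turn.
Qed.

(** * Translation surfaces *)

Lemma velocity_ext (c d : R -> L3) s :
  (forall u, c u = d u) -> velocity c s = velocity d s.
Proof.
intros E; apply L3_ext; cbn; apply Derive_ext; intros u; now rewrite E.
Qed.

Lemma velocity_add_const (c : R -> L3) x s :
  velocity (fun u => plus (c u) x) s = velocity c s.
Proof.
assert (H : forall (f : R -> R) r, Derive (fun u => f u + r) s = Derive f s).
{ intros f r; unfold Derive; apply f_equal, Lim_ext.
  intros h; f_equal; ring. }
apply L3_ext; cbn; apply H.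
Qed.

Lemma velocity_const_add (c : R -> L3) x s :
  velocity (fun u => plus x (c u)) s = velocity c s.
Proof.
rewrite <- (velocity_add_const c x).
apply velocity_ext; intros u; apply plus_comm.
Qed.

(** The coefficients E and G of the metric are 1 and the mixed second derivative is
    zero, so that the mean curvature is a nonzero multiple of the left-hand side
    of the equation; positivity of the metric on (1,1) and (1,-1) is the
    inequality. *)
Lemma maximal_unit_speed_equation a1 b1 al a2 b2 be s t :
  spacelike_unit_speed a1 b1 al -> spacelike_unit_speed a2 b2 be ->
  maximal_translation_surface a1 b1 al a2 b2 be ->
  within a1 b1 s -> within a2 b2 t ->
  -1 < lprod (velocity al s) (velocity be t) < 1 /\
  lprod (lcross (velocity al s) (velocity be t))
    (plus (acceleration al s) (acceleration be t)) = 0.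
Proof.
intros N1 N2 (_ & _ & _ & _ & HM) Hs Ht.
destruct (HM s t Hs Ht) as (_ & HR & HH).
set (X := translation_surface al be) in *.
assert (Ds : forall u v, d_s X u v = velocity al u)
  by (intros; apply velocity_add_const).
assert (Dt : forall u v, d_t X u v = velocity be v)
  by (intros; apply velocity_const_add).
set (F := lprod (velocity al s) (velocity be t)).
assert (HF : -1 < F < 1).
{ assert (P1 : 1 <> 0 \/ 1 <> 0) by lra; assert (P2 : 1 <> 0 \/ -1 <> 0) by lra.
  assert (R1 := HR 1 1 P1); assert (R2 := HR 1 (-1) P2).
  unfold induced_metric in R1, R2; rewrite Ds, Dt in R1, R2.
  revert R1 R2; cbv zeta; autorewrite with bilinear.
  rewrite (N1 s Hs), (N2 t Ht), (lprod_sym (velocity be t)); fold F; lra. }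
split; [exact HF |].
unfold mean_curvature in HH; cbv zeta in HH.
assert (E1 : d_s (d_s X) s t = acceleration al s).
{ apply velocity_ext; intros u; apply Ds. }
assert (E2 : d_t (d_t X) s t = acceleration be t).
{ apply velocity_ext; intros u; apply Dt. }
assert (E3 : d_t (d_s X) s t = zero).
{ apply velocity_unique.
  apply (has_velocity_ext_within (fun _ => velocity al s) _ m_infty p_infty).
  - intros u _; now rewrite Ds.
  - apply within_all.
  - apply has_velocity_const. }
unfold unit_normal in HH; cbv zeta in HH.
rewrite E1, E2, E3, Ds, Dt, (N1 s Hs), (N2 t Ht) in HH; fold F in HH.
set (n := lcross (velocity al s) (velocity be t)) in *.
assert (Hn : lprod n n = F * F - 1).
{ unfold n; rewrite lagrange_identity, (lprod_sym (velocity be t)),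
    (N1 s Hs), (N2 t Ht); fold F; ring. }
assert (Hneg : lprod n n < 0) by nra.
set (k := / sqrt (Rabs (lprod n n))) in *.
assert (Hk : k <> 0).
{ apply Rinv_neq_0_compat, Rgt_not_eq, sqrt_lt_R0, Rabs_pos_lt; lra. }
revert HH; autorewrite with bilinear.
replace (lprod n zero) with 0 by scalar_ring.
intros HH.
apply (Rmult_eq_reg_l (k * k * k * (lprod n n / (2 * (1 - F * F))))).
- rewrite Rmult_0_r, <- HH; field; nra.
- assert (1 - F * F <> 0) by nra.
  unfold Rdiv; repeat apply Rmult_integral_contrapositive_currified; trivial;
    [lra |].
  apply Rinv_neq_0_compat; lra.
Qed.

Theorem theorem4p4 (a1 b1 a2 b2 : Rbar) (al be : R -> L3)
  (h_al : spacelike_unit_speed a1 b1 al)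
  (h_be : spacelike_unit_speed a2 b2 be)
  (hM : maximal_translation_surface a1 b1 al a2 b2 be) :
  (circular_helix a1 b1 al -> translate_of_same_helix a1 b1 al a2 b2 be) /\
  (circular_helix a2 b2 be -> translate_of_same_helix a2 b2 be a1 b1 al).
Proof.
assert (K : forall s t, within a1 b1 s -> within a2 b2 t ->
  -1 < lprod (velocity al s) (velocity be t) < 1 /\
  lprod (lcross (velocity al s) (velocity be t))
    (plus (acceleration al s) (acceleration be t)) = 0).
{ intros s t Hs Ht; now apply (maximal_unit_speed_equation a1 b1 al a2 b2 be). }
destruct hM as (L1 & L2 & S1 & S2 & _).
split; intros HC; apply helix_translation_partner; trivial; intros s t Hs Ht.
- now apply K.
- now apply K.
- rewrite lprod_sym; now apply K.
(* Exchanging the curves changes the sign of the determinant. *)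
- destruct (K t s Ht Hs) as [_ E]; revert E.
  set (T := velocity al t); set (U := velocity be s).
  set (T' := acceleration al t); set (U' := acceleration be s).
  intros E.
  replace (lprod (lcross U T) (plus U' T'))
    with (- lprod (lcross T U) (plus T' U')) by scalar_ring.
  rewrite E; ring.
Qed.
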